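(* Let $S$ and $\overline S=S-2P\mathcal C$ be two projectively related sprays on an $n$-dimensional manifold $M$ ($n\ge2$), where $P\in C^\infty(T_0M)$ is $1$-homogeneous, and let $W_1$, $\overline{W_1}$ be the Weyl-type curvature tensors of $S$ and $\overline S$, i.e. $W_1=R-\frac{1}{2(n-1)}d_J(\operatorname{Tr}\Phi)\wedge J$ and likewise for $\overline S$. Then $$\overline{W_1}=W_1+\frac12\,\delta_SP\wedge J+d_Jd_hP\otimes\mathcal C,$$ where $h$ is the horizontal projector of $S$.
   Context: $T_0M$ is the tangent bundle with zero section removed, with induced coordinates $(x^i,y^i)$; $\mathcal C=y^i\frac{\partial}{\partial y^i}$, $J=dx^i\otimes\frac{\partial}{\partial y^i}$. A spray is a vector field $S=y^i\frac{\partial}{\partial x^i}-2G^i(x,y)\frac{\partial}{\partial y^i}$ on $T_0M$ with $[\mathcal C,S]=S$. A function $P$ is $1$-homogeneous if $\mathcal C(P)=P$. For a spray $S$ put $N^i_j=\partial G^i/\partial y^j$ and $\frac{\delta}{\delta x^i}=\frac{\partial}{\partial x^i}-N^j_i\frac{\partial}{\partial y^j}$; the horizontal projector is $h=\frac{\delta}{\delta x^i}\otimes dx^i$. The Jacobi endomorphism is $\Phi=R^i_j\,\frac{\partial}{\partial y^i}\otimes dx^j$ with $R^i_j=2\frac{\delta G^i}{\delta x^j}-S(N^i_j)+N^i_kN^k_j$, and $\operatorname{Tr}\Phi=R^i_i$. The curvature tensor is $R=\frac12[h,h]$ (Frölicher–Nijenhuis bracket), i.e. $R=\frac12R^k_{ij}\,dx^i\wedge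 dx^j\otimes\frac{\partial}{\partial y^k}$ with $R^k_{ij}=\frac{\delta N^k_i}{\delta x^j}-\frac{\delta N^k_j}{\delta x^i}$; it satisfies $i_SR=\Phi$ and $3R=[J,\Phi]$. For a function $f$: $d_Jf=\frac{\partial f}{\partial y^i}dx^i$, $d_hf=\frac{\delta f}{\delta x^i}dx^i$. For a semi-basic 1-form $\beta=\beta_i\,dx^i$: $d_J\beta=\frac{\partial\beta_j}{\partial y^i}dx^i\wedge dx^j$ and $\beta\wedge J=\beta_i\,dx^i\wedge dx^j\otimes\frac{\partial}{\partial y^j}$. The Euler–Lagrange 1-form of a function $L$ on $T_0M$ is $\delta_SL=d_J(SL)-2d_hL=\left\{S\left(\frac{\partial L}{\partial y^i}\right)-\frac{\partial L}{\partial x^i}\right\}dx^i$. *)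

(* Defs.v *)
From HB Require Import structures.
From mathcomp Require Import all_boot all_order all_algebra.
From mathcomp Require Import all_classical all_reals all_analysis.
Import Order.TTheory GRing.Theory Num.Theory.
Import numFieldNormedType.Exports.

Set Implicit Arguments.
Unset Strict Implicit.
Unset Printing Implicit Defensive.

Local Open Scope classical_set_scope.
Local Open Scope ring_scope.

Section Smooth.
Variables (R : realType) (V W : normedModType R).

(* To be used on open sets D of finite-dimensional spaces, where it is the
   usual notion of a C^k map: directional derivatives along all vectors exist
   and are C^(k-1). *)
Fixpoint Ck_on (k : nat) (D : set V) (f : V -> W) : Prop :=
  (forall x, D x -> {for x, continuous f}) /\
  if k is k'.+1 then
    forall v, (forall x, D x -> derivable f x v) /\ Ck_on k' D ('D_v f)
  else True.

Definition smooth_on (D : set V) (f : V -> W) : Prop :=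
  forall k, Ck_on k D f.

End Smooth.

(* Smooth n-manifolds, given by a smooth atlas indexed by [chart_idx].  The
   total functions [chart c] and [chartV c] are only meaningful on [chart_dom c]
   and on its image respectively. *)
Record manifold (R : realType) (n : nat) := Manifold {
  mpoint : topologicalType;
  mpoint_hausdorff : hausdorff_space mpoint;
  mpoint_second_countable : @second_countable mpoint;
  chart_idx : Type;
  chart_dom : chart_idx -> set mpoint;
  chart : chart_idx -> mpoint -> 'rV[R]_n;
  chartV : chart_idx -> 'rV[R]_n -> mpoint;
  chart_dom_open : forall c, open (chart_dom c);
  chart_img_open : forall c, open (chart c @` chart_dom c);
  chartK : forall c p, chart_dom c p -> chartV c (chart c p) = p;
  chart_continuous : forall c, {within chart_dom c, continuous (chart c)};
  chartV_continuous :
    forall c, {within chart c @` chart_dom c, continuous (chartV c)};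
  chart_cover : forall p, exists c, chart_dom c p;
  chart_trans_smooth : forall c d,
    smooth_on (chart c @` (chart_dom c `&` chart_dom d)) (chart d \o chartV c)
}.

(* The tangent bundle with zero section removed is obtained by gluing the sets
   chart_img c * (R^n \ 0), with induced coordinates z = (x, y), along the
   tangent maps of the transition functions.  Functions and vector fields on it
   are families of coordinate expressions related by these maps. *)
Section SlitTangentBundle.
Variables (R : realType) (n : nat).
Local Notation TU := ('rV[R]_n * 'rV[R]_n)%type.
Variable M : manifold R n.

Definition T0_dom (c : chart_idx M) : set TU :=
  [set z | (chart c @` chart_dom c) z.1 /\ z.2 != 0].

Definition T0_overlap (c d : chart_idx M) : set TU :=
  [set z | (chart c @` (chart_dom c `&` chart_dom d)) z.1 /\ z.2 != 0].

Definition trans (c d : chart_idx M) : 'rV[R]_n -> 'rV[R]_n :=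
  chart d \o chartV c.

Definition T0_trans (c d : chart_idx M) (z : TU) : TU :=
  (trans c d z.1, 'D_(z.2) (trans c d) z.1).

Record T0_function := T0Function {
  fun_rep :> chart_idx M -> TU -> R;
  fun_rep_smooth : forall c, smooth_on (T0_dom c) (fun_rep c);
  fun_rep_compat : forall c d z, T0_overlap c d z ->
    fun_rep d (T0_trans c d z) = fun_rep c z
}.

(* A vector field u^i d/dx^i + v^i d/dy^i is represented by (u, v). *)
Record T0_vector_field := T0VectorField {
  vf_rep :> chart_idx M -> TU -> TU;
  vf_rep_smooth : forall c, smooth_on (T0_dom c) (vf_rep c);
  vf_rep_compat : forall c d z, T0_overlap c d z ->
    vf_rep d (T0_trans c d z) = 'D_(vf_rep c z) (T0_trans c d) z
}.

End SlitTangentBundle.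

Section LocalCalculus.
Variables (R : realType) (n : nat).
Local Notation TU := ('rV[R]_n * 'rV[R]_n)%type.

Definition pdx (i : 'I_n) (f : TU -> R) : TU -> R :=
  'D_(delta_mx 0 i, 0) f.
Definition pdy (i : 'I_n) (f : TU -> R) : TU -> R :=
  'D_(0, delta_mx 0 i) f.

Definition vf_app (X : TU -> TU) (f : TU -> R) : TU -> R := fun z =>
  \sum_i (X z).1 0 i * pdx i f z + \sum_i (X z).2 0 i * pdy i f z.

Definition lie_bracket (X Y : TU -> TU) : TU -> TU := fun z =>
  (\row_i (vf_app X (fun w => (Y w).1 0 i) z
           - vf_app Y (fun w => (X w).1 0 i) z),
   \row_i (vf_app X (fun w => (Y w).2 0 i) z
           - vf_app Y (fun w => (X w).2 0 i) z)).

Definition liouville : TU -> TU := fun z => (0, z.2).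

(* For a spray S = y^i d/dx^i - 2 G^i d/dy^i, upper index first:
   [spray_coef S i] = G^i, [conn S i j] = N^i_j = dG^i/dy^j,
   [hder S i f] = delta f / delta x^i, [jacobi S i j] = R^i_j. *)
Definition spray_coef (S : TU -> TU) (i : 'I_n) : TU -> R := fun z =>
  - (S z).2 0 i / 2.

Definition conn (S : TU -> TU) (i j : 'I_n) : TU -> R :=
  pdy j (spray_coef S i).

Definition hder (S : TU -> TU) (i : 'I_n) (f : TU -> R) : TU -> R := fun z =>
  pdx i f z - \sum_j conn S j i z * pdy j f z.

Definition jacobi (S : TU -> TU) (i j : 'I_n) : TU -> R := fun z =>
  2 * hder S j (spray_coef S i) z - vf_app S (conn S i j) z
  + \sum_k conn S i k z * conn S k j z.

Definition trace_jacobi (S : TU -> TU) : TU -> R := fun z =>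
  \sum_i jacobi S i i z.

(* Semi-basic forms on T_0M, by components: [b i] is the value of a 1-form on
   d/dx^i, [w i j] that of a 2-form on (d/dx^i, d/dx^j), and [A i j k] is the
   d/dy^k component of the value of a vertical-valued 2-form on
   (d/dx^i, d/dx^j).  Here (dx^a /\ dx^b)(d/dx^i, d/dx^j) is
   delta^a_i delta^b_j - delta^a_j delta^b_i.  In particular [curvature S i j k]
   is R^k_ij. *)
Definition form1 := 'I_n -> TU -> R.
Definition form2 := 'I_n -> 'I_n -> TU -> R.
Definition vform2 := 'I_n -> 'I_n -> 'I_n -> TU -> R.

Definition dJ0 (f : TU -> R) : form1 := fun i => pdy i f.

Definition dh0 (S : TU -> TU) (f : TU -> R) : form1 := fun i => hder S i f.

Definition dJ1 (b : form1) : form2 := fun i j z =>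
  pdy i (b j) z - pdy j (b i) z.

Definition wedgeJ (b : form1) : vform2 := fun i j k z =>
  b i z * (k == j)%:R - b j z * (k == i)%:R.

Definition tensor_liouville (w : form2) : vform2 := fun i j k z =>
  w i j z * (liouville z).2 0 k.

Definition curvature (S : TU -> TU) : vform2 := fun i j k z =>
  hder S j (conn S k i) z - hder S i (conn S k j) z.

Definition euler_lagrange (S : TU -> TU) (L : TU -> R) : form1 := fun i z =>
  dJ0 (vf_app S L) i z - 2 * dh0 S L i z.

Definition weyl1 (S : TU -> TU) : vform2 := fun i j k z =>
  curvature S i j k z
  - (2 * (n%:R - 1))^-1 * wedgeJ (dJ0 (trace_jacobi S)) i j k z.

End LocalCalculus.

Section Sprays.
Variables (R : realType) (n : nat) (M : manifold R n).

Definition is_spray (S : T0_vector_field M) : Prop :=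
  forall c z, T0_dom c z ->
    (S c z).1 = z.2 /\ lie_bracket (@liouville R n) (S c) z = S c z.

Definition homogeneous1 (P : T0_function M) : Prop :=
  forall c z, T0_dom c z -> vf_app (@liouville R n) (P c) z = P c z.

Definition projective_deformation (S Sbar : T0_vector_field M)
    (P : T0_function M) : Prop :=
  forall c z, T0_dom c z -> Sbar c z = S c z - (2 * P c z) *: liouville z.

End Sprays.

(* Main.v *)
Require Import Defs.
From HB Require Import structures.
From mathcomp Require Import all_boot all_order all_algebra.
From mathcomp Require Import all_classical all_reals all_analysis.
From mathcomp Require Import ring lra.
Import Order.TTheory GRing.Theory Num.Theory.
Import numFieldNormedType.Exports.

Set Implicit Arguments.
Unset Strict Implicit.
Unset Printing Implicit Defensive.

Local Open Scope classical_set_scope.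
Local Open Scope ring_scope.

(** Why the formula holds.  Write N for the connection coefficients of S, C for
the Liouville field and P_i = dP/dy^i.  The relation Sbar = S - 2 P C says
Gbar^i = G^i + y^i P, so the new connection is Nbar^i_j = N^i_j + y^i P_j +
delta^i_j P and the new horizontal derivations are delta_j - P_j C - P d/dy^j.
Expanding delta-bar_j Nbar^k_i and antisymmetrizing, all terms in which N^k_i is
differentiated vertically cancel, because dN^k_i/dy^j is symmetric in i and j,
and homogeneity evaluates C on N and on P_i; what remains is
  Rbar = R + (P d_J P - d_h P) /\ J + d_J d_h P (x) C
([curvature_proj]).

The Jacobi endomorphism is the contraction of the curvature with the spray
([jacobi_curvature]), so its change is the contraction of the change of R.  On
taking the trace the d_J d_h P term disappears by antisymmetry, and
  Tr Phibar = Tr Phi + (n - 1) (P^2 - S P)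
([trace_jacobi_proj]).  Hence the term subtracted from R in W_1 grows by
(P d_J P - d_J (S P) / 2) /\ J, and the coefficient of J that remains is
(d_J (S P) - 2 d_h P) / 2 = delta_S P / 2.

The tensors are computed chart by chart, and each of them at a point depends
only on the germs of S and P there; so the computation is carried out for a
spray on an arbitrary open set of R^n x R^n.  The one analytic ingredient is the
symmetry of second derivatives ([derive_comm]); the rest is the Leibniz rule and
Euler's identity for homogeneous functions. *)

(** * Smooth maps on an open set *)

Section SmoothMaps.
Variables (R : realType) (V : normedModType R) (D : set V).
Hypothesis openD : open D.

Lemma near_eq_on (T : Type) (f g : V -> T) x :
  D x -> (forall y, D y -> f y = g y) -> \near x, f x = g x.
Proof.
move=> Dx fg; apply: filterS (open_nbhs_nbhs (conj openD Dx)) => y Dy.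
exact: fg.
Qed.

Lemma derive_eq_on (W : normedModType R) (f g : V -> W) x v :
  D x -> (forall y, D y -> f y = g y) -> 'D_v f x = 'D_v g x.
Proof. by move=> Dx fg; apply: near_eq_derive; exact: near_eq_on. Qed.

Lemma Ck_onW (W : normedModType R) k (f : V -> W) :
  Ck_on k.+1 D f -> Ck_on k D f.
Proof.
elim: k f => [|k IHk] f [cf df]; split=> // v.
by have [dfv /IHk] := df v; split.
Qed.

(** Openness of [D] is what makes the notion depend only on the values on [D]:
the higher derivatives of the two maps agree on [D], but nothing is known about
them elsewhere.  This is how identities between derivatives, which hold on [D]
only, are used below. *)
Lemma Ck_on_eq (W : normedModType R) k (f g : V -> W) :
  (forall x, D x -> f x = g x) -> Ck_on k D f -> Ck_on k D g.
Proof.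
elim: k f g => [|k IHk] f g fg [cf df]; (split; first move=> x Dx).
1,3: have nfg := near_eq_on Dx fg;
  rewrite /prop_for/= /continuous_at -(fg x Dx).
1,2: by apply: cvg_trans (cf x Dx); exact: near_eq_cvg.
- by [].
- move=> v; have [dfv Cfv] := df v; split=> [x Dx|].
    exact: near_eq_derivable (near_eq_on Dx fg) (dfv x Dx).
  by apply: IHk Cfv => x Dx; exact: derive_eq_on.
Qed.

(** Coordinate functions and components of a vector field are obtained by
composing with a linear form, so this is where their derivatives come from. *)
Lemma is_derive_linear (W W' : normedModType R) (L : W -> W') (f : V -> W) x v :
    linear L -> continuous L -> derivable f x v ->
  is_derive x v (L \o f) (L ('D_v f x)).
Proof.
move=> linL contL dfx.
pose aL := GRing.isLinear.Build R W W' *:%R L linL.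
pose L' : {linear W -> W'} := HB.pack L aL.
suff h : (h^-1 *: ((L \o f \o shift x) (h *: v) - (L \o f) x) @[h --> 0^'])
    --> L ('D_v f x).
  apply: DeriveDef; first by apply/cvg_ex; exists (L ('D_v f x)).
  exact: cvg_lim.
have -> : (fun h => h^-1 *: ((L \o f \o shift x) (h *: v) - (L \o f) x)) =
    L \o (fun h => h^-1 *: ((f \o shift x) (h *: v) - f x)).
  by apply/funext => h /=; rewrite -[L]/(L' : W -> W') -linearB -linearZ.
exact: cvg_comp dfx (contL _).
Qed.

Lemma Ck_on_linear (W W' : normedModType R) (L : W -> W') k (f : V -> W) :
  linear L -> continuous L -> Ck_on k D f -> Ck_on k D (L \o f).
Proof.
move=> linL contL; elim: k f => [|k IHk] f [cf df]; split=> //.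
1,2: by move=> x Dx; apply: continuous_comp; [exact: cf|exact: contL].
move=> v; have [dfv Cfv] := df v.
have dLf x : D x -> is_derive x v (L \o f) (L ('D_v f x)).
  by move=> Dx; apply: is_derive_linear => //; exact: dfv.
split=> [x Dx|]; first by have [] := dLf x Dx.
apply: Ck_on_eq (IHk _ Cfv) => x Dx.
by have [_ ->] := dLf x Dx.
Qed.

Lemma Ck_on_cst (W : normedModType R) k (a : W) : Ck_on k D (cst a).
Proof.
elim: k a => [|k IHk] a; (split; first by move=> x _; exact: cst_continuous).
  by [].
move=> v; split=> [x _|]; first exact: derivable_cst.
by apply: Ck_on_eq (IHk 0) => x _; rewrite derive_cst.
Qed.

Lemma Ck_onD (W : normedModType R) k (f g : V -> W) :
  Ck_on k D f -> Ck_on k D g -> Ck_on k D (f + g).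
Proof.
elim: k f g => [|k IHk] f g [cf df] [cg dg]; split=> //.
1,2: by move=> x Dx; apply: continuousD; [exact: cf|exact: cg].
move=> v; have [dfv Cfv] := df v; have [dgv Cgv] := dg v.
split=> [x Dx|]; first by apply: derivableD; [exact: dfv|exact: dgv].
apply: Ck_on_eq (IHk _ _ Cfv Cgv) => x Dx.
by rewrite deriveD//; [exact: dfv|exact: dgv].
Qed.

(** The derivative f g' + g f' of the product involves [f] and [g]
undifferentiated, so the induction needs that C^(k+1) maps are C^k. *)
Lemma Ck_onM k (f g : V -> R) :
  Ck_on k D f -> Ck_on k D g -> Ck_on k D (f * g).
Proof.
elim: k f g => [|k IHk] f g Cf Cg; (split=> [x Dx|]//).
1,2: by apply: continuousM; [exact: Cf.1|exact: Cg.1].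
move=> v; have [dfv Cfv] := Cf.2 v; have [dgv Cgv] := Cg.2 v.
split=> [x Dx|]; first by apply: derivableM; [exact: dfv|exact: dgv].
have := Ck_onD (IHk _ _ (Ck_onW Cf) Cgv) (IHk _ _ (Ck_onW Cg) Cfv).
apply: Ck_on_eq => x Dx.
by rewrite deriveM//; [exact: dfv|exact: dgv].
Qed.

Lemma Ck_on_id k : Ck_on k D (@id V).
Proof.
case: k => [|k]; (split; first by move=> x _; exact: cvg_id).
  by [].
move=> v; split=> [x _|]; first exact: derivable_id.
by apply: (@Ck_on_eq V k (cst v)) (Ck_on_cst _ _) => x _; rewrite derive_id.
Qed.

Lemma smooth_on_derivable (W : normedModType R) (f : V -> W) x v :
  smooth_on D f -> D x -> derivable f x v.
Proof. by move=> sf Dx; have [_ /(_ v)[dfv _]] := sf 1%N; exact: dfv. Qed.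

Lemma smooth_on_derive (W : normedModType R) (f : V -> W) v :
  smooth_on D f -> smooth_on D ('D_v f).
Proof. by move=> sf k; have [_ /(_ v)[]] := sf k.+1. Qed.

Lemma smooth_on_linear (W W' : normedModType R) (L : W -> W') (f : V -> W) :
  linear L -> continuous L -> smooth_on D f -> smooth_on D (L \o f).
Proof. by move=> linL contL sf k; exact: Ck_on_linear. Qed.

Lemma smooth_on_cst (W : normedModType R) (a : W) : smooth_on D (fun=> a).
Proof. by move=> k; exact: Ck_on_cst. Qed.

Lemma smooth_onD (W : normedModType R) (f g : V -> W) :
  smooth_on D f -> smooth_on D g -> smooth_on D (fun x => f x + g x).
Proof. by move=> sf sg k; exact: (Ck_onD (sf k) (sg k)). Qed.

Lemma smooth_onM (f g : V -> R) :
  smooth_on D f -> smooth_on D g -> smooth_on D (fun x => f x * g x).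
Proof. by move=> sf sg k; exact: (Ck_onM (sf k) (sg k)). Qed.

Lemma smooth_onN (f : V -> R) :
  smooth_on D f -> smooth_on D (fun x => - f x).
Proof.
move=> sf k; have := smooth_onM (smooth_on_cst (- 1 : R^o)) sf k.
by apply: Ck_on_eq => x _; rewrite mulN1r.
Qed.

Lemma smooth_onB (f g : V -> R) :
  smooth_on D f -> smooth_on D g -> smooth_on D (fun x => f x - g x).
Proof. by move=> sf /smooth_onN; exact: smooth_onD. Qed.

Lemma smooth_on_sum (W : normedModType R) n (f : 'I_n -> V -> W) :
  (forall i, smooth_on D (f i)) -> smooth_on D (fun x => \sum_i f i x).
Proof.
elim: n f => [|n IHn] f sf k.
  by apply: Ck_on_eq (smooth_on_cst 0 k) => x _; rewrite big_ord0.
have sfn := IHn (fun i => f (widen_ord (leqnSn n) i)) (fun i => sf _).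
apply: Ck_on_eq (smooth_onD sfn (sf ord_max) k) => x _.
by rewrite big_ord_recr.
Qed.

Section Leibniz.
Variables (f g : V -> R) (x v : V).
Hypotheses (sf : smooth_on D f) (sg : smooth_on D g) (Dx : D x).

Lemma derive_onD : 'D_v (fun y => f y + g y) x = 'D_v f x + 'D_v g x.
Proof. by apply: deriveD; exact: smooth_on_derivable. Qed.

Lemma derive_onB : 'D_v (fun y => f y - g y) x = 'D_v f x - 'D_v g x.
Proof. by apply: deriveB; exact: smooth_on_derivable. Qed.

Lemma derive_onM :
  'D_v (fun y => f y * g y) x = 'D_v f x * g x + f x * 'D_v g x.
Proof.
have -> : 'D_v (fun y => f y * g y) x = f x *: 'D_v g x + g x *: 'D_v f x.
  by apply: deriveM; exact: smooth_on_derivable.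
by rewrite /GRing.scale/= addrC (mulrC (g x)).
Qed.

Lemma derive_onZ a : 'D_v (fun y => a * f y) x = a * 'D_v f x.
Proof. by apply: deriveZ; exact: smooth_on_derivable. Qed.

End Leibniz.

Lemma derive_on_sum n (f : 'I_n -> V -> R) x v :
    (forall i, smooth_on D (f i)) -> D x ->
  'D_v (fun y => \sum_i f i y) x = \sum_i 'D_v (f i) x.
Proof.
move=> sf Dx; rewrite -derive_sum; last first.
  by move=> i; exact: smooth_on_derivable.
by congr ('D_v _ x); apply/funext => y; rewrite fct_sumE.
Qed.

End SmoothMaps.

(** * Symmetry of second derivatives *)

Section Schwarz.
Variables (R : realType) (V : normedModType R).
Implicit Types (f : V -> R) (x v w : V) (d : R).

Lemma is_derive_line f x v s : derivable f (x + s *: v) v ->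
  is_derive s 1 (fun t : R => f (x + t *: v)) ('D_v f (x + s *: v)).
Proof.
move=> df.
have E : (fun h : R => h^-1 *:
      (((fun t => f (x + t *: v)) \o shift s) (h *: 1) - f (x + s *: v))) =
    (fun h => h^-1 *: ((f \o shift (x + s *: v)) (h *: v) - f (x + s *: v))).
  apply/funext => h /=; congr (_ *: (f _ - _)).
  by rewrite [h *: 1]mulr1 scalerDl addrCA.
by apply: DeriveDef; rewrite /derivable /derive E.
Qed.

Lemma MVT_line f x v d : 0 < d ->
    (forall s, 0 <= s <= d -> derivable f (x + s *: v) v) ->
  exists2 s, 0 < s < d & f (x + d *: v) - f x = d * 'D_v f (x + s *: v).
Proof.
move=> d0 df.
have [s||s] := @MVT R (fun s => f (x + s *: v))
    (fun s => 'D_v f (x + s *: v)) 0 d d0.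
- rewrite in_itv/= => /andP[s0 sd]; apply: is_derive_line.
  by apply: df; rewrite !ltW.
- apply: derivable_within_continuous => s; rewrite in_itv/= => /df sdf.
  by have [] := is_derive_line sdf.
- by rewrite in_itv/= scale0r addr0 subr0 mulrC => sd E; exists s.
Qed.

(** The second difference over a parallelogram is a mixed derivative at some
point of it: the mean value theorem along [v], applied to the increment of [f]
in the direction [w], and then along [w], applied to ['D_v f]. *)
Lemma second_difference f x v w d : 0 < d ->
    (forall s t, 0 <= s <= d -> 0 <= t <= d ->
      derivable f (x + s *: v + t *: w) v /\
      derivable ('D_v f) (x + s *: v + t *: w) w) ->
  exists s t, [/\ 0 <= s <= d, 0 <= t <= d &
    f (x + d *: v + d *: w) - f (x + d *: v) - f (x + d *: w) + f x =
      d ^+ 2 * 'D_w ('D_v f) (x + s *: v + t *: w)].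
Proof.
move=> d0 df.
have r0 : 0 <= (0 : R) <= d by rewrite lexx ltW.
have rd : 0 <= d <= d by rewrite lexx ltW.
pose g y := f (y + d *: w) - f y.
have dg s : 0 <= s <= d -> is_derive (x + s *: v) v g
    ('D_v f (x + s *: v + d *: w) - 'D_v f (x + s *: v)).
  move=> rs; apply: is_deriveB.
    have [dfs _] := df s d rs rd.
    have E : (fun h => h^-1 *:
          (((fun y => f (y + d *: w)) \o shift (x + s *: v)) (h *: v)
          - f (x + s *: v + d *: w))) =
        (fun h => h^-1 *: ((f \o shift (x + s *: v + d *: w)) (h *: v)
          - f (x + s *: v + d *: w))).
      by apply/funext => h /=; rewrite !addrA.
    by apply: DeriveDef; rewrite /derivable /derive E.
  by have [+ _] := df s 0 rs r0; rewrite scale0r addr0 => /derivableP.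
have [s /dg[]//|s /andP[s0 sd]] := @MVT_line g x v d d0.
have rs : 0 <= s <= d by rewrite !ltW.
rewrite (derive_val (is_derive := dg s rs)) => Es.
have [t|t /andP[t0 td] Et] := @MVT_line ('D_v f) (x + s *: v) w d d0.
  by move=> rt; have [] := df s t rs rt.
exists s, t; split=> //; first by rewrite !ltW.
by rewrite expr2 -mulrA -Et -Es /g -!addrA opprB (addrC (f x)).
Qed.

(** The second difference is symmetric in [v] and [w].  Over a small enough
parallelogram it is d^2 times a value of ['D_w ('D_v f)], and also d^2 times a
value of ['D_v ('D_w f)], both at points close to [x]; continuity at [x] then
makes the two mixed derivatives differ by at most any positive number. *)
Theorem derive_comm (D : set V) f x v w :
  open D -> smooth_on D f -> D x -> 'D_w ('D_v f) x = 'D_v ('D_w f) x.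
Proof.
move=> oD sf Dx.
have sfv := smooth_on_derive v sf; have sfw := smooth_on_derive w sf.
have cvw : {for x, continuous ('D_w ('D_v f))}.
  exact: (smooth_on_derive w sfv 0%N).1.
have cwv : {for x, continuous ('D_v ('D_w f))}.
  exact: (smooth_on_derive v sfw 0%N).1.
apply/eqP; rewrite -subr_eq0 -normr_le0; apply/ler_addgt0Pl => e e0.
rewrite addr0.
have e20 : 0 < e / 2 by rewrite divr_gt0.
have nD : \forall y \near x, D y by exact: open_nbhs_nbhs.
have nvw : \forall y \near x, `|'D_w ('D_v f) x - 'D_w ('D_v f) y| < e / 2.
  by have /cvgrPdist_lt := cvw; apply.
have nwv : \forall y \near x, `|'D_v ('D_w f) x - 'D_v ('D_w f) y| < e / 2.
  by have /cvgrPdist_lt := cwv; apply.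
have [r /= r0 ballP] := (nbhs_ballP _ _).1 (filterI nD (filterI nvw nwv)).
(* With this side the parallelogram at x spanned by d v and d w lies in the
   ball; the summand 1 makes d (|v| + |w|) < r strict and covers v = w = 0. *)
pose d := r / (`|v| + `|w| + 1).
have vw0 : 0 < `|v| + `|w| + 1 by rewrite ltr_wpDl// addr_ge0.
have d0 : 0 < d by rewrite divr_gt0.
have small s t : 0 <= s <= d -> 0 <= t <= d -> ball x r (x + s *: v + t *: w).
  move=> /andP[s0 sd] /andP[t0 td]; rewrite -ball_normE/= opprD addrA.
  rewrite opprD addNKr -opprD normrN (le_lt_trans (ler_normD _ _))//.
  rewrite !normrZ (ger0_norm s0) (ger0_norm t0).
  apply: (@le_lt_trans _ _ (d * (`|v| + `|w|))).
    by rewrite mulrDr lerD// ler_wpM2r.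
  by rewrite -[ltRHS](@divfK _ (`|v| + `|w| + 1)) ?gt_eqF// ltr_pM2l// ltrDl.
have [|s [t [rs rt E]]] := @second_difference f x v w d d0.
  move=> s t rs rt; have [Dst _] := ballP _ (small s t rs rt).
  by split; exact: smooth_on_derivable Dst.
have [|t' [s' [rt' rs' E']]] := @second_difference f x w v d d0.
  move=> t' s' rt' rs'; have [+ _] := ballP _ (small s' t' rs' rt').
  by rewrite addrAC => Dst; split; exact: smooth_on_derivable Dst.
rewrite (addrAC _ (- f (x + d *: w))) (addrAC x (d *: w)) in E'.
rewrite (addrAC x (t' *: w)) in E'.
have dn0 : d ^+ 2 != 0 by rewrite expf_neq0// gt_eqF.
have {E E'} EE := mulfI dn0 (etrans (esym E) E').
have [_ [lt1 _]] := ballP _ (small s t rs rt).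
have [_ [_ lt2]] := ballP _ (small s' t' rs' rt').
rewrite -{}EE in lt2; rewrite distrC in lt2.
by rewrite (splitr e) (le_trans (ler_distD _ _ _) (lerD (ltW lt1) (ltW lt2))).
Qed.

End Schwarz.

(** * Calculus in the coordinates (x, y) *)

Section LocalSprays.
Variables (R : realType) (n : nat).
Local Notation TU := ('rV[R]_n * 'rV[R]_n)%type.
Local Notation liouville := (@liouville R n).
Variable D : set TU.
Hypothesis openD : open D.
Implicit Types (f g P : TU -> R) (z v : TU) (S : TU -> TU) (i j k l : 'I_n).

Definition fiber_coord k : TU -> R := fun z => z.2 0 k.

Lemma linear_fiber_coord k : linear (fiber_coord k).
Proof. by move=> a u w; rewrite /fiber_coord /= !mxE. Qed.

Lemma continuous_fiber_coord k : continuous (fiber_coord k).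
Proof.
move=> z; apply: (@continuous_comp _ _ _ snd (fun y : 'rV[R]_n => y 0 k)).
  exact: cvg_snd.
exact: coord_continuous.
Qed.

Lemma smooth_fiber_coord k : smooth_on D (fiber_coord k).
Proof.
move=> m; exact: (Ck_on_linear openD (@linear_fiber_coord k)
  (@continuous_fiber_coord k) (Ck_on_id openD m)).
Qed.

Lemma smooth_snd_coord S k :
  smooth_on D S -> smooth_on D (fun z => (S z).2 0 k).
Proof.
exact: (smooth_on_linear openD (@linear_fiber_coord k)
  (@continuous_fiber_coord k)).
Qed.

Lemma derive_fiber_coord k z v : 'D_v (fiber_coord k) z = v.2 0 k.
Proof.
have did : derivable (@id TU) z v by exact: derivable_id.
have dk := is_derive_linear (@linear_fiber_coord k) (@continuous_fiber_coord k)
  did.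
by rewrite -[LHS]/('D_v (fiber_coord k \o id) z) (derive_val (is_derive := dk))
  derive_id.
Qed.

Lemma pdx_fiber_coord i k z : pdx i (fiber_coord k) z = 0.
Proof. by rewrite /pdx derive_fiber_coord mxE. Qed.

Lemma pdy_fiber_coord i k z : pdy i (fiber_coord k) z = (k == i)%:R.
Proof. by rewrite /pdy derive_fiber_coord mxE. Qed.

Lemma sum_mul_eqr (F : 'I_n -> R) i : \sum_j F j * (j == i)%:R = F i.
Proof.
rewrite (bigD1 i)//= eqxx mulr1 big1 ?addr0// => j ji.
by rewrite (negPf ji) mulr0.
Qed.

Lemma sum_mul_eql (F : 'I_n -> R) i : \sum_j F j * (i == j)%:R = F i.
Proof. by under eq_bigr do rewrite eq_sym; exact: sum_mul_eqr. Qed.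

Lemma smooth_pdx i f : smooth_on D f -> smooth_on D (pdx i f).
Proof. exact: smooth_on_derive. Qed.

Lemma smooth_pdy i f : smooth_on D f -> smooth_on D (pdy i f).
Proof. exact: smooth_on_derive. Qed.

Lemma pdy_eq_on i f g z : D z -> (forall w, D w -> f w = g w) ->
  pdy i f z = pdy i g z.
Proof. exact: derive_eq_on. Qed.

Section PdyLeibniz.
Variables (i : 'I_n) (f g : TU -> R) (z : TU).
Hypotheses (sf : smooth_on D f) (sg : smooth_on D g) (Dz : D z).

Lemma pdyD : pdy i (fun w => f w + g w) z = pdy i f z + pdy i g z.
Proof. exact: derive_onD. Qed.

Lemma pdyB : pdy i (fun w => f w - g w) z = pdy i f z - pdy i g z.
Proof. exact: derive_onB. Qed.

Lemma pdyM :
  pdy i (fun w => f w * g w) z = pdy i f z * g z + f z * pdy i g z.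
Proof. exact: derive_onM. Qed.

Lemma pdyZ a : pdy i (fun w => a * f w) z = a * pdy i f z.
Proof. exact: (derive_onZ _ sf Dz). Qed.

End PdyLeibniz.

Lemma pdy_sum i m (f : 'I_m -> TU -> R) z :
    (forall r, smooth_on D (f r)) -> D z ->
  pdy i (fun w => \sum_r f r w) z = \sum_r pdy i (f r) z.
Proof. exact: derive_on_sum. Qed.

Lemma pdy_pdyC i j f z : smooth_on D f -> D z ->
  pdy i (pdy j f) z = pdy j (pdy i f) z.
Proof. by move=> sf Dz; exact: derive_comm openD sf Dz. Qed.

Lemma pdy_pdxC i j f z : smooth_on D f -> D z ->
  pdy i (pdx j f) z = pdx j (pdy i f) z.
Proof. by move=> sf Dz; exact: derive_comm openD sf Dz. Qed.

Lemma smooth_vf_app S f :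
  smooth_on D S -> smooth_on D f -> smooth_on D (vf_app S f).
Proof.
move=> sS sf; apply: smooth_onD => //; apply: smooth_on_sum => // i.
  apply: smooth_onM => //; last exact: smooth_pdx.
  apply: (@smooth_on_linear _ _ _ openD _ _ (fun z : TU => z.1 0 i)) sS.
    by move=> a u w; rewrite /= !mxE.
  move=> z; apply: (@continuous_comp _ _ _ fst (fun y : 'rV[R]_n => y 0 i)).
    exact: cvg_fst.
  exact: coord_continuous.
by apply: smooth_onM => //; [exact: smooth_snd_coord|exact: smooth_pdy].
Qed.

Lemma vf_app_fiber_coord S k z : vf_app S (fiber_coord k) z = (S z).2 0 k.
Proof.
rewrite /vf_app [X in X + _]big1 => [|i _]; last first.
  by rewrite pdx_fiber_coord mulr0.
by under eq_bigr do rewrite pdy_fiber_coord; rewrite sum_mul_eql add0r.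
Qed.

Lemma vf_app_liouville f z :
  vf_app liouville f z = \sum_i fiber_coord i z * pdy i f z.
Proof.
by rewrite /vf_app [X in X + _]big1 ?add0r// => i _; rewrite mxE mul0r.
Qed.

(** Differentiate Euler's identity y^i df/dy^i = a f in y^j and exchange the two
vertical derivatives. *)
Lemma euler_pdy f a j z : smooth_on D f -> D z ->
    (forall w, D w -> vf_app liouville f w = a * f w) ->
  vf_app liouville (pdy j f) z = (a - 1) * pdy j f z.
Proof.
move=> sf Dz homf.
have syf i : smooth_on D (fun w => fiber_coord i w * pdy i f w).
  by apply: smooth_onM => //; [exact: smooth_fiber_coord|exact: smooth_pdy].
have E : pdy j (fun w => \sum_i fiber_coord i w * pdy i f w) z = a * pdy j f z.
  rewrite -(pdyZ j sf Dz); apply: (pdy_eq_on j Dz) => w Dw.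
  by rewrite -vf_app_liouville homf.
rewrite mulrBl mul1r -{}E (pdy_sum j syf Dz).
under eq_bigr => i _.
  rewrite (pdyM j (smooth_fiber_coord i) (smooth_pdy i sf) Dz).
  rewrite pdy_fiber_coord (mulrC _ (pdy i f z)) (pdy_pdyC j i sf Dz); over.
rewrite big_split/= sum_mul_eqr -vf_app_liouville.
by rewrite addrAC subrr add0r.
Qed.

Section HorizontalDerivation.
Variables (S : TU -> TU) (i : 'I_n) (z : TU).
Hypothesis Dz : D z.

Lemma hder_eq_on f g : (forall w, D w -> f w = g w) ->
  hder S i f z = hder S i g z.
Proof.
move=> fg; rewrite /hder /pdx /pdy (derive_eq_on openD _ Dz fg).
by under eq_bigr do rewrite (derive_eq_on openD _ Dz fg).
Qed.

Lemma hderD f g : smooth_on D f -> smooth_on D g ->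
  hder S i (fun w => f w + g w) z = hder S i f z + hder S i g z.
Proof.
move=> sf sg; rewrite /hder /pdx /pdy (derive_onD _ sf sg Dz).
under eq_bigr do rewrite (derive_onD _ sf sg Dz) mulrDr.
by rewrite big_split/= opprD addrACA.
Qed.

Lemma hderM f g : smooth_on D f -> smooth_on D g ->
  hder S i (fun w => f w * g w) z = hder S i f z * g z + f z * hder S i g z.
Proof.
move=> sf sg; rewrite /hder /pdx /pdy (derive_onM _ sf sg Dz).
under eq_bigr do rewrite (derive_onM _ sf sg Dz) mulrDr (mulrCA _ (f z)).
under eq_bigr do rewrite [X in X + _]mulrA.
rewrite big_split/= -mulr_suml -mulr_sumr opprD addrACA.
by rewrite mulrBl mulrBr.
Qed.

Lemma hderZ a f : smooth_on D f ->
  hder S i (fun w => a * f w) z = a * hder S i f z.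
Proof.
move=> sf; rewrite /hder /pdx /pdy (derive_onZ _ sf Dz).
under eq_bigr do rewrite (derive_onZ _ sf Dz) mulrCA.
by rewrite -mulr_sumr mulrBr.
Qed.

Lemma hder_sum m (f : 'I_m -> TU -> R) : (forall r, smooth_on D (f r)) ->
  hder S i (fun w => \sum_r f r w) z = \sum_r hder S i (f r) z.
Proof.
move=> sf; rewrite /hder /pdx /pdy (derive_on_sum _ sf Dz).
under [X in _ - X]eq_bigr do rewrite (derive_on_sum _ sf Dz) mulr_sumr.
by rewrite exchange_big/= -sumrB.
Qed.

Lemma hder_fiber_coord k : hder S i (fiber_coord k) z = - conn S k i z.
Proof.
rewrite /hder pdx_fiber_coord sub0r.
by under eq_bigr do rewrite pdy_fiber_coord; rewrite sum_mul_eql.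
Qed.

End HorizontalDerivation.

(** * Sprays on an open set *)

(** The condition on the first component says that [S] is a second-order field,
so that [spray_coef S] determines it. *)
Definition spray_on S :=
  smooth_on D S /\
  forall z, D z -> (S z).1 = z.2 /\ lie_bracket liouville S z = S z.

Section Spray.
Variable S : TU -> TU.
Hypothesis sprayS : spray_on S.

Lemma smooth_spray_coef i : smooth_on D (spray_coef S i).
Proof.
apply: smooth_onM => //; last exact: smooth_on_cst.
by apply: smooth_onN => //; apply: smooth_snd_coord; exact: sprayS.1.
Qed.

Lemma smooth_conn i j : smooth_on D (conn S i j).
Proof. exact/smooth_pdy/smooth_spray_coef. Qed.

Lemma smooth_hder i f : smooth_on D f -> smooth_on D (hder S i f).
Proof.
move=> sf; apply: smooth_onB => //; first exact: smooth_pdx.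
apply: smooth_on_sum => // j; apply: smooth_onM => //; first exact: smooth_conn.
exact: smooth_pdy.
Qed.

Lemma smooth_jacobi i j : smooth_on D (jacobi S i j).
Proof.
apply: smooth_onD => //; last first.
  by apply: smooth_on_sum => // k; apply: smooth_onM => //; exact: smooth_conn.
apply: smooth_onB => //.
  apply: smooth_onM => //; first exact: smooth_on_cst.
  exact/smooth_hder/smooth_spray_coef.
apply: smooth_vf_app; [exact: sprayS.1|exact: smooth_conn].
Qed.

Lemma smooth_trace_jacobi : smooth_on D (trace_jacobi S).
Proof. by apply: smooth_on_sum => // i; exact: smooth_jacobi. Qed.

Lemma spray_snd i z : (S z).2 0 i = - (2 * spray_coef S i z).
Proof. by rewrite /spray_coef; field. Qed.

(** This is the vertical part of [C, S] = S: its i-th component is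
C(S^i) - S(y^i) = S^i where S(y^i) = S^i = - 2 G^i. *)
Lemma euler_spray_coef i z : D z ->
  vf_app liouville (spray_coef S i) z = 2 * spray_coef S i z.
Proof.
move=> Dz; have [S1 /(congr1 (fun v => v.2 0 i))] := sprayS.2 z Dz.
rewrite /= mxE (vf_app_fiber_coord S i z) vf_app_liouville.
have -> : (fun w => (S w).2 0 i) = (fun w => - 2 * spray_coef S i w).
  by apply/funext => w; rewrite spray_snd mulNr.
rewrite spray_snd; under eq_bigr => j _.
  rewrite (pdyZ j (smooth_spray_coef i) Dz) mulrCA; over.
rewrite -mulr_sumr -vf_app_liouville => E; lra.
Qed.

Lemma euler_conn i j z : D z -> vf_app liouville (conn S i j) z = conn S i j z.
Proof.
move=> Dz.
rewrite (euler_pdy _ (smooth_spray_coef i) Dz (@euler_spray_coef i)).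
by rewrite -[RHS]mul1r; congr (_ * _); ring.
Qed.

Lemma sum_fiber_coord_conn i z : D z ->
  \sum_j fiber_coord j z * conn S i j z = 2 * spray_coef S i z.
Proof. by move=> Dz; rewrite -euler_spray_coef// vf_app_liouville. Qed.

(** A spray is horizontal for its own connection, since y^i N^j_i = 2 G^j. *)
Lemma vf_app_hder f z : D z ->
  vf_app S f z = \sum_i fiber_coord i z * hder S i f z.
Proof.
move=> Dz; rewrite /vf_app (sprayS.2 z Dz).1.
under [RHS]eq_bigr do rewrite mulrBr mulr_sumr.
rewrite sumrB; congr (_ + _); rewrite exchange_big/= -sumrN.
apply: eq_bigr => j _; rewrite spray_snd -(sum_fiber_coord_conn _ Dz) mulNr.
by rewrite mulr_suml; congr (- _); apply: eq_bigr => i _; rewrite mulrA.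
Qed.

Lemma pdy_conn_sym i j k z : D z -> pdy j (conn S k i) z = pdy i (conn S k j) z.
Proof.
by move=> Dz; exact: pdy_pdyC (smooth_spray_coef k) Dz.
Qed.

(** The identity i_S R = Phi.  In y^i (delta_j N^k_i - delta_i N^k_j) the second
term is S(N^k_j); in the first one the factor y^i is moved under delta_j, where
it gives 2 delta_j G^k, at the price of (delta_j y^i) N^k_i = - N^i_j N^k_i. *)
Lemma jacobi_curvature k j z : D z ->
  jacobi S k j z = \sum_i fiber_coord i z * curvature S i j k z.
Proof.
move=> Dz; have -> : \sum_i fiber_coord i z * curvature S i j k z =
    \sum_i fiber_coord i z * hder S j (conn S k i) z - vf_app S (conn S k j) z.
  rewrite vf_app_hder// -sumrB; apply: eq_bigr => i _.
  by rewrite -mulrBr.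
rewrite /jacobi addrAC; congr (_ - _).
have -> : 2 * hder S j (spray_coef S k) z =
    hder S j (fun w => \sum_i fiber_coord i w * conn S k i w) z.
  rewrite -hderZ//; last exact: smooth_spray_coef.
  by apply: hder_eq_on => // w Dw; rewrite sum_fiber_coord_conn.
rewrite hder_sum//; last first.
  by move=> i; apply: smooth_onM => //; [exact: smooth_fiber_coord|
    exact: smooth_conn].
rewrite -big_split/=; apply: eq_bigr => i _.
rewrite hderM//; [|exact: smooth_fiber_coord|exact: smooth_conn].
by rewrite hder_fiber_coord// mulNr mulrC addrAC addNr add0r.
Qed.

(** d/dy^i and delta_j commute up to the vertical field - (dN^l_j/dy^i) d/dy^l,
whose coefficients are symmetric in [i] and [j] and disappear on
antisymmetrizing. *)
Lemma dJ1_dh0 P i j z : smooth_on D P -> D z ->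
  dJ1 (dh0 S P) i j z = hder S j (pdy i P) z - hder S i (pdy j P) z.
Proof.
move=> sP Dz.
have dhd a b : pdy a (hder S b P) z =
    hder S b (pdy a P) z - \sum_l pdy a (conn S l b) z * pdy l P z.
  have sNP l : smooth_on D (fun w => conn S l b w * pdy l P w).
    by apply: smooth_onM => //; [exact: smooth_conn|exact: smooth_pdy].
  have sN := smooth_on_sum openD sNP.
  rewrite (pdyB a (smooth_pdx b sP) sN Dz) (pdy_sum a sNP Dz).
  under eq_bigr => l _.
    rewrite (pdyM a (smooth_conn l b) (smooth_pdy l sP) Dz).
    rewrite (pdy_pdyC a l sP Dz) addrC; over.
  by rewrite big_split/= (pdy_pdxC a b sP Dz) opprD addrA.
rewrite /dJ1 /dh0 !dhd.
have cancel_sub (a b r t : R) : r = t -> a - r - (b - t) = a - b.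
  by move=> ->; rewrite opprB addrA subrK.
apply: cancel_sub; apply: eq_bigr => l _.
exact: (congr1 (fun t => t * pdy l P z) (pdy_conn_sym j i l Dz)).
Qed.

End Spray.

(** * Projective change of a spray *)

Section ProjectiveChange.
Variables (S S' : TU -> TU) (P : TU -> R).
Hypotheses (sprayS : spray_on S) (sprayS' : spray_on S').
Hypotheses (smoothP : smooth_on D P)
  (homP : forall z, D z -> vf_app liouville P z = P z)
  (projS : forall z, D z -> S' z = S z - (2 * P z) *: liouville z).

Lemma spray_coef_proj i z : D z ->
  spray_coef S' i z = spray_coef S i z + fiber_coord i z * P z.
Proof.
move=> Dz; rewrite /spray_coef /fiber_coord projS//= !mxE.
move: ((S z).2 0 i) (z.2 0 i) (P z) => s y p; by field.
Qed.

Lemma conn_proj i j z : D z ->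
  conn S' i j z =
  conn S i j z + (fiber_coord i z * pdy j P z + (i == j)%:R * P z).
Proof.
move=> Dz; have sy := smooth_onM openD (smooth_fiber_coord i) smoothP.
rewrite /conn (pdy_eq_on j Dz (@spray_coef_proj i)).
rewrite (pdyD j (smooth_spray_coef sprayS i) sy Dz); congr (_ + _).
by rewrite (pdyM j (smooth_fiber_coord i) smoothP Dz) pdy_fiber_coord addrC.
Qed.

Lemma hder_proj i f z : D z ->
  hder S' i f z =
  hder S i f z - pdy i P z * vf_app liouville f z - P z * pdy i f z.
Proof.
move=> Dz; rewrite /hder vf_app_liouville.
have -> : \sum_j conn S' j i z * pdy j f z =
    \sum_j conn S j i z * pdy j f z +
    (pdy i P z * (\sum_j fiber_coord j z * pdy j f z) + P z * pdy i f z).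
  rewrite -(sum_mul_eqr (fun j => pdy j f z) i) !mulr_sumr -!big_split/=.
  apply: eq_bigr => j _; rewrite (conn_proj j i Dz).
  move: (conn S j i z) (pdy j f z) (pdy i P z) (P z) (fiber_coord j z) => *.
  ring.
by rewrite !opprD !addrA.
Qed.

(* The calculations below use these operators only through their rules, and
   letting unification unfold them into limits is prohibitively slow. *)
#[local] Opaque pdx pdy conn hder.

(** One half of the changed curvature, before antisymmetrizing in [i] and [j].
Homogeneity enters through C(N^k_i) = N^k_i, C(P_i) = 0 and C(P) = P; the
bracket multiplied by - P_i is the new N^k_j, coming from the derivative of
y^k. *)
Lemma hder_conn_proj i j k z : D z ->
  hder S' j (conn S' k i) z =
    hder S j (conn S k i) z - pdy j P z * conn S k i z
      - P z * pdy j (conn S k i) z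
    + (fiber_coord k z * (hder S j (pdy i P) z - P z * pdy j (pdy i P) z)
       - pdy i P z * (conn S k j z
                      + (fiber_coord k z * pdy j P z + (k == j)%:R * P z))
       + (k == i)%:R * (hder S j P z - 2 * P z * pdy j P z)).
Proof.
move=> Dz; rewrite (hder_eq_on _ _ Dz (fun w Dw => conn_proj k i Dw)).
have sPi := smooth_pdy i smoothP.
have sk := smooth_fiber_coord k.
have syP := smooth_onM openD sk sPi.
have sdP := smooth_onM openD (smooth_on_cst openD ((k == i)%:R : R^o)) smoothP.
rewrite (hderD _ _ Dz (smooth_conn sprayS k i) (smooth_onD openD syP sdP)).
rewrite (hderD _ _ Dz syP sdP) (hderM _ _ Dz sk sPi) (hderZ _ _ Dz _ smoothP).
rewrite (hder_fiber_coord S' j z k) (conn_proj k j Dz) !(hder_proj _ _ Dz).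
rewrite (euler_conn sprayS k i Dz) (homP Dz).
rewrite (@euler_pdy P 1 i z smoothP Dz); last first.
  by move=> w Dw; rewrite mul1r homP.
move: (hder S j (conn S k i) z) (conn S k i z) (pdy j (conn S k i) z)
  (hder S j (pdy i P) z) (pdy j (pdy i P) z) (conn S k j z) (hder S j P z)
  (pdy i P z) (pdy j P z) (P z) (fiber_coord k z) => *; ring.
Qed.

(** By the symmetry of dN^k_i/dy^j and of P_ij, the vertical second derivatives
cancel in the antisymmetrization of [hder_conn_proj], and so do the
undifferentiated N^k_i. *)
Lemma curvature_proj i j k z : D z ->
  curvature S' i j k z =
    curvature S i j k z
    + wedgeJ (fun i z => P z * pdy i P z - hder S i P z) i j k z
    + tensor_liouville (dJ1 (dh0 S P)) i j k z.
Proof.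
move=> Dz; rewrite /curvature !(hder_conn_proj _ _ _ Dz) /wedgeJ.
rewrite /tensor_liouville (dJ1_dh0 sprayS i j smoothP Dz).
rewrite (pdy_conn_sym sprayS i j k Dz) (pdy_pdyC j i smoothP Dz).
rewrite -/(fiber_coord k z).
move: (hder S j (conn S k i) z) (hder S i (conn S k j) z) (conn S k i z)
  (conn S k j z) (pdy i (conn S k j) z) (hder S j (pdy i P) z)
  (hder S i (pdy j P) z) (pdy i (pdy j P) z) (hder S j P z) (hder S i P z)
  (pdy i P z) (pdy j P z) (P z) (fiber_coord k z) => *; ring.
Qed.

Lemma sum_antisym (F : 'I_n -> 'I_n -> R) :
  (forall i j, F i j = - F j i) -> \sum_i \sum_j F i j = 0.
Proof.
move=> antiF.
have E : \sum_i \sum_j F i j = - \sum_i \sum_j F i j.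
  rewrite {1}exchange_big/= -sumrN; apply: eq_bigr => i _.
  by rewrite -sumrN; apply: eq_bigr => j _; rewrite antiF.
lra.
Qed.

(** Contract [curvature_proj] with y^i and set j = k.  With b = P d_J P - d_h P,
the term b /\ J contributes n b(S) - b(S), where b(S) = P C(P) - S P, and
d_J d_h P (x) C contributes d_J d_h P (S, S) = 0. *)
Lemma trace_jacobi_proj z : D z ->
  trace_jacobi S' z =
  trace_jacobi S z + (n%:R - 1) * (P z * P z - vf_app S P z).
Proof.
move=> Dz.
pose b i : R := P z * pdy i P z - hder S i P z.
pose w i j : R := dJ1 (dh0 S P) i j z.
have sum_b : \sum_i fiber_coord i z * b i = P z * P z - vf_app S P z.
  rewrite (vf_app_hder sprayS P Dz) -[X in _ * X - _](homP Dz) vf_app_liouville.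
  rewrite mulr_sumr -sumrB; apply: eq_bigr => i _.
  by rewrite mulrBr mulrCA.
have jacobi_proj k : jacobi S' k k z = jacobi S k k z
    + (\sum_i fiber_coord i z * b i - fiber_coord k z * b k
       + \sum_i fiber_coord k z * fiber_coord i z * w i k).
  rewrite (jacobi_curvature sprayS' k k Dz) (jacobi_curvature sprayS k k Dz).
  (* The term y^k b_k is spread over i as a Kronecker sum, so that both sides
     can be compared summand by summand. *)
  have -> : fiber_coord k z * b k =
      \sum_i fiber_coord i z * b k * (k == i)%:R by rewrite sum_mul_eql.
  rewrite -sumrB -!big_split/=; apply: eq_bigr => i _.
  rewrite (curvature_proj i k k Dz).
  rewrite -[wedgeJ _ i k k z]/(b i * (k == k)%:R - b k * (k == i)%:R).
  rewrite -[tensor_liouville _ i k k z]/(w i k * fiber_coord k z).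
  move: (curvature S i k k z) (b i) (b k) (w i k) (fiber_coord i z)
    (fiber_coord k z) => c bi bk wik yi yk; rewrite eqxx mulr1; ring.
rewrite /trace_jacobi (eq_bigr _ (fun k _ => jacobi_proj k)) big_split.
congr (_ + _); rewrite big_split sumrB sumr_const card_ord /=.
rewrite [X in _ + X]sum_antisym => [|k i].
  by rewrite sum_b addr0 mulrBl mul1r mulr_natl.
by rewrite (mulrC (fiber_coord i z)) -mulrN /w /dJ1 opprB.
Qed.

Lemma dJ0_trace_jacobi_proj i z : D z ->
  dJ0 (trace_jacobi S') i z =
  dJ0 (trace_jacobi S) i z
  + (n%:R - 1) * (2 * P z * pdy i P z - pdy i (vf_app S P) z).
Proof.
move=> Dz; rewrite /dJ0 [LHS](pdy_eq_on i Dz trace_jacobi_proj).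
have sSP := smooth_vf_app sprayS.1 smoothP.
have sPP := smooth_onM openD smoothP smoothP.
have sB := smooth_onB openD sPP sSP.
have sZ := smooth_onM openD (smooth_on_cst openD (n%:R - 1 : R^o)) sB.
rewrite (pdyD i (smooth_trace_jacobi sprayS) sZ Dz) (pdyZ i sB Dz).
rewrite (pdyB i sPP sSP Dz) (pdyM i smoothP smoothP Dz).
congr (_ + _ * (_ - _)).
by move: (P z) (pdy i P z) => *; ring.
Qed.

(** The hypothesis on [n] makes the factor 1 / (2 (n - 1)) cancel the n - 1 of
[trace_jacobi_proj]. *)
Lemma weyl1_proj i j k z : (2 <= n)%N -> D z ->
  weyl1 S' i j k z =
    weyl1 S i j k z
    + 2^-1 * wedgeJ (euler_lagrange S P) i j k z
    + tensor_liouville (dJ1 (dh0 S P)) i j k z.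
Proof.
move=> n2 Dz; rewrite /weyl1 (curvature_proj i j k Dz) /wedgeJ.
rewrite !(dJ0_trace_jacobi_proj _ Dz) /euler_lagrange /dJ0 /dh0.
have n1 : n%:R - 1 != 0 :> R by rewrite subr_eq0 pnatr_eq1 gtn_eqF.
move: (curvature S i j k z) (tensor_liouville (dJ1 (hder S^~ P)) i j k z)
  (pdy i (trace_jacobi S) z) (pdy j (trace_jacobi S) z)
  (pdy i (vf_app S P) z) (pdy j (vf_app S P) z)
  (hder S i P z) (hder S j P z) (pdy i P z) (pdy j P z) (P z) => *.
by field.
Qed.

End ProjectiveChange.
End LocalSprays.

(** * The formula on the slit tangent bundle *)

Lemma T0_dom_open (R : realType) (n : nat) (M : manifold R n)
  (c : chart_idx M) : open (T0_dom c).
Proof.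
have -> : T0_dom c =
    fst @^-1` (chart c @` chart_dom c) `&` snd @^-1` (~` [set 0]) :> set _.
  by apply/seteqP; split=> z [zc z0]; split=> //; exact/eqP.
apply: openI.
  by apply: open_comp; [move=> z _; exact: cvg_fst|exact: chart_img_open].
apply: open_comp; first by move=> z _; exact: cvg_snd.
apply: closed_openC; apply: accessible_closed_set1.
exact/hausdorff_accessible/norm_hausdorff.
Qed.

Theorem lemma3p3 (R : realType) (n : nat) (hn : (2 <= n)%N)
    (M : manifold R n) (S Sbar : T0_vector_field M) (P : T0_function M)
    (hS : is_spray S) (hSbar : is_spray Sbar) (hP : homogeneous1 P)
    (hproj : projective_deformation S Sbar P) :
  forall (c : chart_idx M) (z : 'rV[R]_n * 'rV[R]_n), T0_dom c z ->
  forall i j k : 'I_n,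
    weyl1 (Sbar c) i j k z =
      weyl1 (S c) i j k z
      + 2^-1 * wedgeJ (euler_lagrange (S c) (P c)) i j k z
      + tensor_liouville (dJ1 (dh0 (S c) (P c))) i j k z.
Proof.
move=> c z Dz i j k; apply: (weyl1_proj (@T0_dom_open _ _ M c)) => //.
- by split; [exact: vf_rep_smooth|exact: hS].
- by split; [exact: vf_rep_smooth|exact: hSbar].
- exact: fun_rep_smooth.
- exact: hP.
- exact: hproj.
Qed.
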